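(* Let $\mathbf K$ be $\mathbf H$ or $\mathbf O$, and let $\mathcal F$ be a family of $\mathbf K$-valued functions holomorphic on a domain $U$ in $\mathbf K^n$ such that each $f\in\mathcal F$, for each $j=1,\dots,n$ and at each $z\in U$, is either pseudoconformal by ${}_jz$ or satisfies $\partial f(z)/\partial\,{}_jz=0$. If $\mathcal F$ is uniformly $C^1$-continuous, then $\mathcal F$ is a normal family.
   Context: Notation. $\mathbf K$ is the quaternion skew field $\mathbf H$ ($r=2$) or the octonion algebra $\mathbf O$ ($r=3$), with standard generators $i_0=1,i_1,\dots,i_{2^r-1}$; $\tilde z=z^*$ is the conjugate, $|z|^2=z\tilde z$, $\mathrm{Re}(z)=(z+\tilde z)/2$. Functions of $z$ are represented by phrases (finite or convergent infinite sums of bracketed words in $z$, $\tilde z$ and constants of $\mathbf K$); $\partial f/\partial z$ and $\partial f/\partial\tilde z$ are the partial (super)derivatives, $\mathbf R$-linear operators $h\mapsto(\partial f/\partial z).h$ and $h\mapsto(\partial f/\partial\tilde z).h$ whose sum is the Fréchet derivative. $f$ is holomorphic if it is differentiable with $\partial f/\partial\tilde z=0$ (by each variable); such $f$ is locally given by convergent power series in $z-z_0$ with coefficients in $\mathbf K$ interlaced between powers (with prescribed brackets), and $f'(z)=\partial f/\partial z$. Pseudoconformal. A differentiable $f:U\to\mathbf K$, $U$ open in $\mathbf K$, is pseudoconformal at $\xi$ if (1) $\partial f(z)/\partial\tilde z=0$ at $z=\xi$; (2) $\mathrm{Re}\{[f'(\xi).h_1][f'(\xi).h_2]^*\}|h_1||h_2|=|f'(\xi).h_1||f'(\xi).h_2|\,\mathrm{Re}(h_1\tilde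 h_2)$ for all $h_1,h_2\in\mathbf K$; (3) $f'(\xi)\neq0$; where nonproper rotations of the underlying space $\mathbf R^{2^r}$ associated with $f'$ are excluded. Pseudoconformal by ${}_jz$ means this holds for $f$ as a function of ${}_jz$, where $z=({}_1z,\dots,{}_nz)\in\mathbf K^n$. Uniform $C^1$-continuity of $\mathcal F$: for each $\epsilon>0$ there exists $\delta>0$ such that for all $z_1,z_2\in U$ with $|z_1-z_2|<\delta$ the inequality $|f(z_1)-f(z_2)|+\|f'(z_1)-f'(z_2)\|<\epsilon$ holds for each $f\in\mathcal F$. Normal family. For $V=\mathrm{cl}(\mathrm{Int}(V))$ closed bounded let $\rho_V(f,g)=\max_{z\in V}\big[|f(z)-g(z)|+\max_{|h|=1}|f'(z).h-g'(z).h|\big]$. A family $\mathcal F$ on $U$ is normal if each $f\in\mathcal F$ is holomorphic, at each $\xi\in U$ by each ${}_jz$ either pseudoconformal or with $\partial f/\partial\,{}_jz=0$, and for each infinite sequence in $\mathcal F$ and each closed bounded $V=\mathrm{cl}(\mathrm{Int}(V))\subset U$ there is a subsequence converging uniformly relative to $\rho_V$ to some limit function, which may also be a finite or infinite constant. *)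

(* Defs.v *)
From HB Require Import structures.
From mathcomp Require Import all_boot all_order all_algebra.
From mathcomp Require Import all_classical all_reals all_analysis.

Set Implicit Arguments.
Unset Strict Implicit.
Unset Printing Implicit Defensive.

Import Order.TTheory GRing.Theory Num.Theory.
Import numFieldNormedType.Exports.

Local Open Scope classical_set_scope.
Local Open Scope ring_scope.

(* [cdim r] is 2 ^ r, written so that the halves of a vector of length
   [cdim r.+1] are [lsubmx] and [rsubmx] without any cast. *)
Fixpoint cdim (r : nat) : nat := if r is s.+1 then (cdim s + cdim s)%N else 1%N.

(* Cayley-Dickson algebras: r = 0, 1, 2, 3 give the real, complex, quaternion
   and octonion algebras.  The generator i_k is [delta_mx 0 k]. *)
Notation CD R r := 'rV[R]_(cdim r).

(* [CDn R r n] is the n-th power of [CD R r]; the coordinate number j of z is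
   [row j z].  [CDn R r 1] is [CD R r]. *)
Notation CDn R r n := 'M[R]_(n, cdim r).

Fixpoint cconj (R : realType) (r : nat) : CD R r -> CD R r :=
  if r is s.+1 then
    fun z : 'rV[R]_(cdim s + cdim s) => row_mx (cconj (lsubmx z)) (- rsubmx z)
  else fun z => z.

(* (a + b l) (c + d l) = (a c - d~ b) + (d a + b c~) l *)
Fixpoint cmul (R : realType) (r : nat) : CD R r -> CD R r -> CD R r :=
  if r is s.+1 then
    fun x y : 'rV[R]_(cdim s + cdim s) =>
      let a := lsubmx x in let b := rsubmx x in
      let c := lsubmx y in let d := rsubmx y in
      row_mx (cmul a c - cmul (cconj d) b) (cmul d a + cmul b (cconj c))
  else fun x y => x 0 0 *: y.

Fixpoint cre (R : realType) (r : nat) : CD R r -> R :=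
  if r is s.+1 then fun z : 'rV[R]_(cdim s + cdim s) => cre (lsubmx z)
  else fun z => z 0 0.

Definition cabs (R : realType) (r : nat) (z : CD R r) : R :=
  Num.sqrt (cre (cmul z (cconj z))).

Definition cinv (R : realType) (r : nat) (z : CD R r) : CD R r :=
  (cabs z ^+ 2)^-1 *: cconj z.

(* The Euclidean norm; the library norm of a matrix is the (equivalent)
   maximum norm. *)
Definition cnabs (R : realType) (r n : nat) (z : CDn R r n) : R :=
  Num.sqrt (\sum_(j < n) cabs (row j z) ^+ 2).

(* Bracketed words in the variables, their conjugates and constants; the tree
   structure records the brackets. *)
Inductive word (R : realType) (r n : nat) : Type :=
| WCst of CD R r
| WVar of 'I_n
| WConj of 'I_n
| WMul of word R r n & word R r n.

Fixpoint weval (R : realType) (r n : nat) (w : word R r n) (z : CDn R r n) :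
    CD R r :=
  match w with
  | WCst c => c
  | WVar j => row j z
  | WConj j => cconj (row j z)
  | WMul u v => cmul (weval u z) (weval v z)
  end.

(* Partial superderivatives of a word by the j-th variable and by its
   conjugate, at z, applied to h; the second one maps h to h~ on the letter
   [WConj j], so that the sum of the two is the Frechet derivative. *)
Fixpoint wder (R : realType) (r n : nat) (w : word R r n) (j : 'I_n)
    (z : CDn R r n) (h : CD R r) : CD R r :=
  match w with
  | WCst _ => 0
  | WVar k => if k == j then h else 0
  | WConj _ => 0
  | WMul u v => cmul (wder u j z h) (weval v z) + cmul (weval u z) (wder v j z h)
  end.

Fixpoint wcder (R : realType) (r n : nat) (w : word R r n) (j : 'I_n)
    (z : CDn R r n) (h : CD R r) : CD R r :=
  match w with
  | WCst _ => 0
  | WVar _ => 0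
  | WConj k => if k == j then cconj h else 0
  | WMul u v =>
      cmul (wcder u j z h) (weval v z) + cmul (weval u z) (wcder v j z h)
  end.

(* For r <= 3 the norm is multiplicative and this is the supremum of
   |weval w z| over the polydisc |z_j| <= rho. *)
Fixpoint wweight (R : realType) (r n : nat) (w : word R r n) (rho : R) : R :=
  match w with
  | WCst c => cabs c
  | WVar _ => rho
  | WConj _ => rho
  | WMul u v => wweight u rho * wweight v rho
  end.

(* A phrase is the sum of a sequence of words; a finite sum is padded with
   [WCst 0]. *)
Definition phrase (R : realType) (r n : nat) : Type := nat -> word R r n.

Definition phrase_der (R : realType) (r n : nat) (p : phrase R r n) (j : 'I_n)
    (z : CDn R r n) (h : CD R r) : CD R r :=
  limn (series (fun k => wder (p k) j z h)).

Definition phrase_cder (R : realType) (r n : nat) (p : phrase R r n) (j : 'I_n)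
    (z : CDn R r n) (h : CD R r) : CD R r :=
  limn (series (fun k => wcder (p k) j z h)).

(* On the ball of centre z0 and radius rho, f is the sum of the phrase p in
   z - z0, which converges normally as a power series; the series defining
   [phrase_der] and [phrase_cder] then converge on that ball. *)
Definition represents (R : realType) (r n : nat) (p : phrase R r n) (rho : R)
    (z0 : CDn R r n) (f : CDn R r n -> CD R r) : Prop :=
  [/\ 0 < rho,
      cvgn (series (fun k => wweight (p k) rho : R)) &
      forall z, cnabs (z - z0) < rho ->
        series (fun k => weval (p k) (z - z0)) @ \oo --> f z].

(* A and B are the partial superderivatives at z0 of f by the j-th variable
   and by its conjugate, for some representation of f by a phrase.  They depend
   on the representation, because for r >= 2 conjugation is itself a phrase in z
   without z~; only the sum of A and B, the partial Frechet derivative, does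
   not.  In particular A is determined by f when B = 0. *)
Definition superderivatives (R : realType) (r n : nat)
    (f : CDn R r n -> CD R r) (z0 : CDn R r n) (j : 'I_n)
    (A B : CD R r -> CD R r) : Prop :=
  exists (p : phrase R r n) (rho : R),
    [/\ represents p rho z0 f,
        forall h, A h = phrase_der p j 0 h &
        forall h, B h = phrase_cder p j 0 h].

Definition holomorphic_at (R : realType) (r n : nat)
    (f : CDn R r n -> CD R r) (z0 : CDn R r n) : Prop :=
  differentiable f z0 /\
  exists (p : phrase R r n) (rho : R),
    represents p rho z0 f /\
    forall z, cnabs (z - z0) < rho ->
      forall (j : 'I_n) (h : CD R r), phrase_cder p j (z - z0) h = 0.

Definition holomorphic_on (R : realType) (r n : nat) (U : set (CDn R r n))
    (f : CDn R r n -> CD R r) : Prop :=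
  forall z, U z -> holomorphic_at f z.

(* The condition on the determinant excludes the nonproper rotations. *)
Definition pseudoconformal (R : realType) (r : nat) (f : CD R r -> CD R r)
    (xi : CD R r) : Prop :=
  differentiable f xi /\
  exists A : CD R r -> CD R r,
    [/\ @superderivatives R r 1 f xi ord0 A (fun=> 0),
        forall h1 h2 : CD R r,
          cre (cmul (A h1) (cconj (A h2))) * cabs h1 * cabs h2 =
          cabs (A h1) * cabs (A h2) * cre (cmul h1 (cconj h2)),
        exists h, A h != 0 &
        0 < \det (lin1_mx A)].

Definition set_row (R : realType) (r n : nat) (z : CDn R r n) (j : 'I_n)
    (w : CD R r) : CDn R r n :=
  \matrix_(i < n) (if i == j then w else row i z).

Definition pseudoconformal_by (R : realType) (r n : nat) (j : 'I_n)
    (f : CDn R r n -> CD R r) (z : CDn R r n) : Prop :=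
  pseudoconformal (fun w => f (set_row z j w)) (row j z).

Definition superderivative_eq0 (R : realType) (r n : nat) (j : 'I_n)
    (f : CDn R r n -> CD R r) (z : CDn R r n) : Prop :=
  superderivatives f z j (fun=> 0) (fun=> 0).

Definition pseudoconformal_or_eq0 (R : realType) (r n : nat)
    (U : set (CDn R r n)) (f : CDn R r n -> CD R r) : Prop :=
  forall z, U z -> forall j : 'I_n,
    pseudoconformal_by j f z \/ superderivative_eq0 j f z.

Definition is_domain (R : realType) (r n : nat) (U : set (CDn R r n)) : Prop :=
  [/\ open U, connected U & U !=set0].

(* For a holomorphic f the derivative f' is the Frechet derivative ['d f z]. *)
Definition opnorm (R : realType) (r n : nat) (A : CDn R r n -> CD R r) : R :=
  sup [set cabs (A h) | h in [set h | cnabs h = 1]].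

Definition C1_dist (R : realType) (r n : nat) (f g : CDn R r n -> CD R r)
    (z1 z2 : CDn R r n) : R :=
  cabs (f z1 - g z2) + opnorm (fun h => 'd f z1 h - 'd g z2 h).

Definition uniformly_C1_continuous (R : realType) (r n : nat)
    (U : set (CDn R r n)) (F : set (CDn R r n -> CD R r)) : Prop :=
  forall eps : R, 0 < eps -> exists2 delta : R, 0 < delta &
    forall z1 z2, U z1 -> U z2 -> cnabs (z1 - z2) < delta ->
      forall f, F f -> C1_dist f f z1 z2 < eps.

(* Extended real valued, so that an infinite supremum is not read as 0. *)
Definition rho_dist (R : realType) (r n : nat) (V : set (CDn R r n))
    (f g : CDn R r n -> CD R r) : \bar R :=
  ereal_sup [set (C1_dist f g z z)%:E | z in V].

Definition converges_to_function (R : realType) (r n : nat)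
    (V : set (CDn R r n)) (f : nat -> CDn R r n -> CD R r) : Prop :=
  exists g : CDn R r n -> CD R r,
    (forall z, V z -> differentiable g z) /\
    rho_dist V (f k) g @[k --> \oo] --> 0%:E.

(* Convergence to the constant oo is read in the chart w |-> w^-1 at oo. *)
Definition converges_to_infinity (R : realType) (r n : nat)
    (V : set (CDn R r n)) (f : nat -> CDn R r n -> CD R r) : Prop :=
  (\forall k \near \oo, forall z, V z -> f k z != 0) /\
  rho_dist V (fun z => cinv (f k z)) (cst 0) @[k --> \oo] --> 0%:E.

Definition normal_family (R : realType) (r n : nat) (U : set (CDn R r n))
    (F : set (CDn R r n -> CD R r)) : Prop :=
  [/\ forall f, F f -> holomorphic_on U f,
      forall f, F f -> pseudoconformal_or_eq0 U f &
      forall (u : nat -> CDn R r n -> CD R r) (V : set (CDn R r n)),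
        (forall k, F (u k)) ->
        closed V -> bounded_set V -> V = closure (interior V) ->
        V !=set0 -> V `<=` U ->
        exists phi : nat -> nat,
          {homo phi : k l / (k < l)%N} /\
          (converges_to_function V (u \o phi) \/
           converges_to_infinity V (u \o phi))].

(* Main.v *)
From HB Require Import structures.
Require Import Defs.
From mathcomp Require Import all_boot all_order all_algebra.
From mathcomp Require Import all_classical all_reals all_analysis.
From mathcomp Require Import ring lra.

(** The heart of the statement is an Arzela-Ascoli theorem in C^1: a sequence of
    differentiable functions on a domain whose values and derivatives are
    uniformly equicontinuous has a subsequence that converges in C^1 on a given compact
    set, either to a differentiable function or, after inversion, to 0.

    Three estimates hold uniformly over the family.  By the mean value
    inequality, [f (x + h) - f x - 'd f x h] is at most [e * |h|] for small h
    ([C1_equi_first_order]).  As [f (x + h) - f x] is also small, this bounds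
    ['d f x] locally ([near_C1_equi_diff_bound]), even where the values of the
    family are unbounded.  As the domain is connected, [f y - f x] is bounded
    for any two points x and y of it ([C1_equi_bounded_oscillation]).

    Given a sequence u, fix an ultrafilter on nat finer than the filter of
    neighbourhoods of infinity, and a base point x0.  Either [u k x0] is bounded
    along the ultrafilter; then all [u k x] and ['d (u k) x h] are, so they
    converge along it, the limit g is differentiable because the first-order
    estimate passes to the limit, and the convergence of values and derivatives
    is locally uniform by equicontinuity ([ultra_C1_limit]).  Or [u k x0] tends
    to infinity; then so does [u k], locally uniformly ([ultra_unbounded]), and
    as the derivative of [w |-> w^-1] is O(|w|^-2) while the derivatives of u
    stay bounded on compact sets, the inverses tend to 0 together with their
    derivatives ([cinv_C1_small]).  Local uniformity is uniformity on compact
    sets.  Finally, properties that each hold along the ultrafilter can be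
    realised one after the other along an increasing sequence of indices
    ([ultra_subsequence]), which produces the subsequence without a diagonal
    argument.

    All estimates are made in the maximum norm of matrices; the last parts
    compare it with the Euclidean norms of the statement. *)

Set Implicit Arguments.
Unset Strict Implicit.
Unset Printing Implicit Defensive.
Import Order.TTheory GRing.Theory Num.Theory.
Import numFieldNormedType.Exports.
Local Open Scope classical_set_scope.
Local Open Scope ring_scope.

(** * Linear maps and compact sets of matrices *)

Lemma mx_coord_le_norm (R : realType) (m n : nat) (A : 'M[R]_(m, n)) i j :
  `|A i j| <= `|A|.
Proof.
rewrite [leRHS]/Num.Def.normr/= mx_normrE.
by have := @le_bigmax _ _ _ 0 (fun ij : 'I_m * 'I_n => `|A ij.1 ij.2|) (i, j).
Qed.

Lemma mx_norm_le (R : realType) (m n : nat) (A : 'M[R]_(m, n)) (e : R) :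
  0 <= e -> (forall i j, `|A i j| <= e) -> `|A| <= e.
Proof.
move=> e0 H; rewrite [leLHS]/Num.Def.normr/= mx_normrE.
by apply: bigmax_le => //= ij _; exact: H.
Qed.

Definition mx_linear_bound (R : realType) (m n : nat) (W : normedModType R)
    (f : 'M[R]_(m, n) -> W) : R :=
  \sum_(i < m) \sum_(j < n) `|f (delta_mx i j)|.

Lemma le_mx_linear_bound (R : realType) (m n : nat) (W : normedModType R)
    (f : {linear 'M[R]_(m, n) -> W}) h :
  `|f h| <= mx_linear_bound f * `|h|.
Proof.
rewrite {1}(matrix_sum_delta h) linear_sum /mx_linear_bound mulr_suml.
apply: le_trans (ler_norm_sum _ _ _) _; apply: ler_sum => i _.
rewrite linear_sum mulr_suml.
apply: le_trans (ler_norm_sum _ _ _) _; apply: ler_sum => j _.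
by rewrite linearZ/= normrZ mulrC ler_wpM2l// mx_coord_le_norm.
Qed.

Lemma mx_linear_continuous (R : realType) (m n : nat) (W : normedModType R)
    (f : {linear 'M[R]_(m, n) -> W}) : continuous f.
Proof.
apply/linear_bounded_continuous/linear_boundedP.
near=> k => x; apply: le_trans (le_mx_linear_bound f x) _.
by rewrite ler_wpM2r//; near: k; apply: nbhs_pinfty_ge; rewrite num_real.
Unshelve. all: by end_near. Qed.

(** The Heine-Borel theorem, carried over from row vectors by [vec_mx]. *)
Lemma mx_bounded_closed_compact (R : realType) (m n : nat)
    (A : set 'M[R]_(m, n)) : bounded_set A -> closed A -> compact A.
Proof.
move=> bA cA.
have cvec : continuous (vec_mx : 'rV[R]_(m * n) -> 'M[R]_(m, n)).
  exact: mx_linear_continuous.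
have -> : A = vec_mx @` (vec_mx @^-1` A).
  rewrite eqEsubset; split => [x Ax|_ [y Ay <-]//].
  by exists (mxvec x); rewrite /= mxvecK.
apply: continuous_compact; first exact: continuous_subspaceT.
apply: bounded_closed_compact; last by apply: closed_comp.
have [M [Mr HM]] := bA; exists M; split=> // x Mx y /= /(HM x Mx) Ay.
apply: mx_norm_le; first by apply: le_trans Ay.
move=> i j; rewrite ord1 -[y]vec_mxK; case/mxvec_indexP: j => i' j'.
by rewrite mxvecE; apply: le_trans Ay; exact: mx_coord_le_norm.
Qed.

(** * The mean value inequality *)

(** The mean value theorem is applied to each entry of
    [f (x + t *: h) - t *: 'd f x h] for t in [0, 1]; the maximum norm makes the
    bound on the entries a bound on the vector. *)
Lemma mx_mean_value (R : realType) (V : normedModType R) (m n : nat)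
    (f : V -> 'M[R]_(m, n)) (x h : V) (e : R) :
  (forall t : R, 0 <= t <= 1 -> differentiable f (x + t *: h)) ->
  (forall t : R, 0 <= t <= 1 -> `|'d f (x + t *: h) h - 'd f x h| <= e) ->
  `|f (x + h) - f x - 'd f x h| <= e.
Proof.
move=> df He.
have e0 : 0 <= e.
  by apply: le_trans (He 0 _) => //; rewrite lexx ler01.
apply: mx_norm_le => // i j.
pose g (t : R) := f (x + t *: h).
have dline (t : R) : is_diff t (fun t : R => x + t *: h) (fun s : R => s *: h).
  have -> : (fun t : R => x + t *: h) = cst x + ( *:%R ^~ h) by [].
  by apply: is_diff_eq; rewrite add0r.
have dg (t : R) : 0 <= t <= 1 -> is_diff t g (fun s => 'd f (x + t *: h) (s *: h)).
  move=> t01; have /differentiableP dft := df t t01.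
  exact: (is_diff_comp (dline t)).
have Dg (t : R) : 0 <= t <= 1 ->
    is_derive t (1 : R) (fun t => g t i j) ('d f (x + t *: h) h i j).
  move=> t01; have [dgt gE] := dg t t01.
  have gd : derivable g t (1 : R) by apply: diff_derivable.
  split; first by have /derivable_mxP := gd; exact.
  have := derive_mx gd; rewrite deriveE// gE scale1r => ->.
  by rewrite mxE.
pose phi : R -> R := (fun t => g t i j) - ('d f x h i j *: id).
have Dphi (t : R) : 0 <= t <= 1 ->
    is_derive t (1 : R) phi ('d f (x + t *: h) h i j - 'd f x h i j).
  move=> t01; have := Dg t t01 => ?.
  by apply: is_derive_eq; congr (_ - _); exact: mulr1.
have [||c] := @MVT_segment R phi (fun t => 'd f (x + t *: h) h i j - 'd f x h i j) 0 1 ler01.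
- by move=> t; rewrite in_itv/= => /andP[/ltW t0 /ltW t1]; apply: Dphi; rewrite t0.
- by apply: derivable_within_continuous => t; rewrite in_itv/= => /Dphi[].
rewrite in_itv/= => c01; rewrite subr0 mulr1.
have phiE t : phi t = g t i j - 'd f x h i j * t by [].
rewrite !phiE /g scale1r scale0r addr0 mulr0 subr0 mulr1 => E.
have -> : (f (x + h) - f x - 'd f x h) i j = ('d f (x + c *: h) h - 'd f x h) i j.
  by rewrite !mxE -E; ring.
by apply: le_trans (He c c01); exact: mx_coord_le_norm.
Qed.

(** * Families equicontinuous together with their derivatives *)

Definition differentiable_family (R : realType) (V W : normedModType R)
    (U : set V) (F : set (V -> W)) : Prop :=
  forall f, F f -> forall x, U x -> differentiable f x.

(** Uniform C^1-continuity in the norms of [V] and [W], with the operator norm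
    spelled out pointwise so that no supremum has to be handled. *)
Definition C1_equicontinuous (R : realType) (V W : normedModType R)
    (U : set V) (F : set (V -> W)) : Prop :=
  forall e : R, 0 < e -> exists2 delta : R, 0 < delta &
    forall x y, U x -> U y -> `|x - y| < delta -> forall f, F f ->
      `|f x - f y| <= e /\ forall h, `|'d f x h - 'd f y h| <= e * `|h|.

Section equicontinuous_families.
Context (R : realType) (V : normedModType R) (m n : nat).
Context (U : set V) (F : set (V -> 'M[R]_(m, n))).
Context (oU : open U) (dF : differentiable_family U F).
Context (eF : C1_equicontinuous U F).

(** Equicontinuity of the derivatives makes [delta] independent of [f]. *)
Lemma C1_equi_first_order x (e : R) : U x -> 0 < e ->
  exists2 delta : R, 0 < delta & forall h, `|h| < delta -> U (x + h) /\
    forall f, F f -> `|f (x + h) - f x - 'd f x h| <= e * `|h|.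
Proof.
move=> Ux e0; have [d d0 Hd] := eF e0.
have /nbhs_ballP[r /= r0 Ur] : nbhs x U by apply: open_nbhs_nbhs.
exists (Num.min r d); first by rewrite lt_min r0.
move=> h; rewrite lt_min => /andP[hr hd].
have th (t : R) : 0 <= t <= 1 -> `|t *: h| <= `|h|.
  by move=> /andP[t0 t1]; rewrite normrZ ger0_norm// ler_piMl.
have Uth (t : R) : 0 <= t <= 1 -> U (x + t *: h).
  move=> /th t01; apply: Ur; rewrite -ball_normE /= opprD addrA subrr sub0r normrN.
  exact: le_lt_trans hr.
split; first by rewrite -[h]scale1r; apply: Uth; rewrite ler01 lexx.
move=> f Ff; apply: mx_mean_value => t t01; first exact/(dF Ff)/Uth.
have xd : `|x + t *: h - x| < d.
  by rewrite addrAC subrr add0r; exact: le_lt_trans (th _ t01) hd.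
by have [_ ] := Hd _ _ (Uth _ t01) Ux xd _ Ff.
Qed.

(** On a vector k of a fixed small norm r, both [f (x + k) - f x] and its
    distance to ['d f x k] are bounded, by 1 and r; homogeneity does the rest.
    The values of the family themselves may be unbounded at x. *)
Lemma C1_equi_diff_bound x : U x -> exists2 B : R, 0 <= B &
  forall f, F f -> forall h, `|'d f x h| <= B * `|h|.
Proof.
move=> Ux; have [d d0 Hd] := eF (@ltr01 R).
have [d' d'0 Hd'] := C1_equi_first_order Ux (@ltr01 R).
pose r := Num.min d d' / 2.
have m0 : 0 < Num.min d d' by rewrite lt_min d0.
have r0 : 0 < r by rewrite divr_gt0.
have rm : r < Num.min d d' by rewrite /r; lra.
exists ((1 + r) / r); first by rewrite divr_ge0// ?addr_ge0 // ltW.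
move=> f Ff h; have [->|h0] := eqVneq h 0.
  by rewrite linear0 !normr0 mulr0.
have nh : 0 < `|h| by rewrite normr_gt0.
pose k := (r / `|h|) *: h.
have kr : `|k| = r by rewrite normrZ normf_div normr_id gtr0_norm// divfK// gt_eqF.
have [kd kd'] : `|k| < d /\ `|k| < d' by apply/andP; rewrite -lt_min kr.
have [Uk /(_ _ Ff)] := Hd' k kd'.
rewrite kr mul1r => H1.
have xkd : `|x + k - x| < d by rewrite addrAC subrr add0r.
have [H2 _] := Hd _ _ Uk Ux xkd _ Ff.
have H3 : `|'d f x k| <= 1 + r.
  rewrite -[X in `|X|](subrKC (f (x + k) - f x)).
  by apply: le_trans (ler_normD _ _) _; rewrite lerD// distrC.
have hE : (`|h| / r) *: k = h.
  by rewrite /k scalerA mulrA divfK ?gt_eqF// divff ?scale1r // gt_eqF.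
rewrite -{1}hE linearZ/= normrZ normf_div normr_id (gtr0_norm r0).
rewrite [leRHS](_ : _ = `|h| / r * (1 + r)); last by field; rewrite gt_eqF.
by rewrite ler_wpM2l// divr_ge0// ltW.
Qed.

Lemma near_C1_equi x (e : R) : U x -> 0 < e -> \forall y \near x, U y /\
  forall f, F f ->
    `|f y - f x| <= e /\ forall h, `|'d f y h - 'd f x h| <= e * `|h|.
Proof.
move=> Ux e0; have [d d0 Hd] := eF e0.
near=> y.
have Uy : U y by near: y; apply: open_nbhs_nbhs.
split=> // f Ff; apply: Hd => //; near: y.
Unshelve. all: by end_near. Qed.

Lemma near_C1_equi_diff_bound x : U x ->
  \forall y \near x & B \near +oo%R,
    forall f, F f -> forall h, `|'d f y h| <= B * `|h|.
Proof.
move=> Ux; have [B0 B00 HB] := C1_equi_diff_bound Ux.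
near=> y B => f Ff h.
have [_ /(_ _ Ff)[_ /(_ h) H]] : U y /\
  forall f, F f -> `|f y - f x| <= 1 /\ forall h, `|'d f y h - 'd f x h| <= 1 * `|h|.
  by near: y; exact: near_C1_equi.
rewrite -[X in `|X|](subrK ('d f x h)).
apply: le_trans (ler_normD _ _) _; apply: le_trans (lerD H (HB _ Ff _)) _.
rewrite -mulrDl /= ler_wpM2r//.
Unshelve. all: by end_near. Qed.

(** The points at bounded distance from x, in the sense of the conclusion,
    form a subset of U that is open and closed in U, because equicontinuity
    bounds the oscillation by 1 near each point. *)
Lemma C1_equi_bounded_oscillation x y : connected U -> U x -> U y ->
  exists N : R, forall f, F f -> `|f y - f x| <= N.
Proof.
move=> cU Ux Uy.
pose D := [set z | exists N : R, forall f, F f -> `|f z - f x| <= N].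
suff : U `&` D = U by move/seteqP => [_ /(_ y Uy)[]].
have loc z w : U z -> U w -> (forall f, F f -> `|f w - f z| <= 1) -> D z <-> D w.
  have step a b : (forall f, F f -> `|f b - f a| <= 1) -> D a -> D b.
    move=> ab [N HN]; exists (1 + N) => f Ff.
    rewrite -(subrKA (f a)); apply: le_trans (ler_normD _ _) _.
    by rewrite lerD ?ab ?HN.
  move=> _ _ zw; split; apply: step => // f Ff.
  by rewrite distrC zw.
have nloc z : U z -> \forall w \near z, U w /\ (D z <-> D w).
  move=> Uz; have := near_C1_equi Uz ltr01.
  apply: filterS => w [Uw H]; split=> //; apply: loc => // f Ff.
  by have [] := H _ Ff.
apply: cU.
- exists x; split=> //; exists 0 => f _; by rewrite subrr normr0.
- exists (U `&` D); last by rewrite setIA setIid.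
  rewrite openE => z [Uz Dz]; rewrite /interior.
  by apply: filterS (nloc z Uz) => w [Uw H]; split=> //; apply/H.
- exists (~` (U `&` ~` D)).
    apply: open_closedC; rewrite openE => z [Uz Dz]; rewrite /interior.
    apply: filterS (nloc z Uz) => w [Uw H]; split=> //= Dw; exact/Dz/H.
  by rewrite setCI setCK setIUr setICr set0U.
Qed.

End equicontinuous_families.

(** * Limits along an ultrafilter *)

(** A cluster point of an ultrafilter is a limit of it, so compactness of balls
    gives convergence without passing to a subfamily. *)
Lemma ultra_bounded_cvg (R : realType) (I : Type) (UU : set_system I)
    (m n : nat) (v : I -> 'M[R]_(m, n)) (M : R) :
  UltraFilter UU -> (\forall k \near UU, `|v k| <= M) -> cvg (v k @[k --> UU]).
Proof.
move=> UF vM.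
have cK : compact [set w : 'M[R]_(m, n) | `|w| <= M].
  apply: mx_bounded_closed_compact.
    exists M; split; first exact: num_real.
    by move=> x Mx w /= /le_trans; apply; exact: ltW.
  apply: (@closed_comp _ _ (fun w : 'M[R]_(m, n) => `|w|) [set x | x <= M]).
    by move=> w _; exact: norm_continuous.
  exact: closed_le.
have [l [_ cl]] := cK (v @ UU) _ vM.
apply/cvg_ex; exists l => B lB.
have [//|UB] := in_ultra_setVsetC (v @^-1` B) UF.
by have [w []] := cl (~` B) B UB lB.
Qed.

Lemma norm_cvg_le (R : realType) (W : normedModType R) (I : Type)
    (UU : set_system I) (w : I -> W) (l : W) (c : R) :
  ProperFilter UU -> w k @[k --> UU] --> l ->
  (\forall k \near UU, `|w k| <= c) -> `|l| <= c.
Proof. by move=> UF /cvg_norm wl wc; exact: cvgr_to_le wl wc. Qed.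

Lemma diff_of_first_order (R : realType) (V W : normedModType R)
    (g : V -> W) (L : {linear V -> W}) (x : V) :
  continuous L ->
  (forall e : R, 0 < e -> exists2 delta : R, 0 < delta &
    forall h, `|h| < delta -> `|g (x + h) - g x - L h| <= e * `|h|) ->
  is_diff x g L.
Proof.
move=> cL H.
have gL : g \o shift x = cst (g x) + L +o_ 0 id.
  apply/eqaddoP => e e0; have [d d0 Hd] := H _ e0.
  near=> h; rewrite [X in `|X|](_ : _ = g (x + h) - g x - L h).
    by apply: Hd; near: h; exact: nbhs0_lt.
  by rewrite /= [x + h]addrC fctE /= fctE opprD addrA.
have dE := diff_unique cL gL.
by split=> //; apply/diff_locallyP; rewrite dE.
Unshelve. all: by end_near. Qed.

Lemma pointwise_limit_linear (R : realType) (V : lmodType R)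
    (W : normedModType R) (I : Type) (UU : set_system I)
    (A : I -> {linear V -> W}) (L : V -> W) :
  ProperFilter UU -> (forall h, A k h @[k --> UU] --> L h) -> linear L.
Proof.
move=> UF AL a h h'.
have aL : (fun k => a *: A k h) @ UU --> a *: L h by exact: cvgZl_tmp (AL h).
have := cvgD aL (AL h').
have -> : (fun k => a *: A k h) + (fun k => A k h') = (fun k => A k (a *: h + h')).
  by apply/funext => k; rewrite linearP.
by move=> /(_ _); apply: cvg_unique (AL _).
Qed.

Section limits_along_an_ultrafilter.
Context (R : realType) (p q m n : nat) (I : Type) (UU : set_system I).
Context (U : set 'M[R]_(p, q)) (F : set ('M[R]_(p, q) -> 'M[R]_(m, n))).
Context (u : I -> 'M[R]_(p, q) -> 'M[R]_(m, n)).
Context (UF : UltraFilter UU) (oU : open U) (cU : connected U).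
Context (dF : differentiable_family U F) (eF : C1_equicontinuous U F).
Context (Fu : forall k, F (u k)).

Section pointwise_limit.
Context (g : 'M[R]_(p, q) -> 'M[R]_(m, n)).
Context (L : 'M[R]_(p, q) -> 'M[R]_(p, q) -> 'M[R]_(m, n)).
Context (gP : forall x, U x -> u k x @[k --> UU] --> g x).
Context (LP : forall x h, U x -> 'd (u k) x h @[k --> UU] --> L x h).

Lemma pointwise_limit_diff_linear x : U x -> linear (L x).
Proof.
by move=> Ux; apply: (@pointwise_limit_linear _ _ _ _ UU (fun k => 'd (u k) x)) => h; exact: LP.
Qed.

(** The first-order estimate is uniform over the family, hence holds for g and
    L in the limit. *)
Lemma pointwise_limit_is_diff x : U x -> is_diff x g (L x).
Proof.
move=> Ux.
pose lM := GRing.isLinear.Build _ _ _ _ _ (pointwise_limit_diff_linear Ux).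
pose LL : {linear _ -> _} := HB.pack (L x) lM.
apply: (@diff_of_first_order _ _ _ _ LL) => [|e e0].
  exact: mx_linear_continuous.
have [d d0 Hd] := C1_equi_first_order oU dF eF Ux e0.
exists d => // h hd; have [Uxh H] := Hd h hd.
apply: (@norm_cvg_le _ _ _ UU (fun k => u k (x + h) - u k x - 'd (u k) x h)).
- apply: cvgB; last exact: LP.
  by apply: cvgB; exact: gP.
- by apply: nearW => k; exact: H.
Qed.

(** The equicontinuity estimates between x and y pass to the limit g, so that
    it is enough to compare [u k] and g at the single point x.  There the
    convergence of ['d (u k) x] on the finitely many matrix units gives
    convergence in operator norm. *)
Lemma near_C1_limit x (e : R) : U x -> 0 < e -> \forall y \near x & k \near UU,
  `|u k y - g y| <= e /\ forall h, `|'d (u k) y h - 'd g y h| <= e * `|h|.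
Proof.
move=> Ux e0; have e3 : 0 < e / 3 by rewrite divr_gt0.
have eF3 := near_C1_equi oU eF Ux e3.
have g3 : \forall k \near UU, `|u k x - g x| <= e / 3.
  by have /cvgrPdistC_le := gP Ux; exact.
have L3 : \forall k \near UU, forall h, `|'d (u k) x h - L x h| <= e / 3 * `|h|.
  pose lM := GRing.isLinear.Build _ _ _ _ _ (pointwise_limit_diff_linear Ux).
  pose LL : {linear _ -> _} := HB.pack (L x) lM.
  (* There are p * q matrix units; the successor keeps c positive. *)
  pose c : R := (p * q).+1%:R.
  have H : \forall k \near UU, forall i j,
      `|'d (u k) x (delta_mx i j) - L x (delta_mx i j)| <= e / 3 / c.
    apply: filter_forall => i; apply: filter_forall => j.
    have /cvgrPdistC_le := @LP x (delta_mx i j) Ux; apply.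
    by rewrite divr_gt0.
  apply: filterS H => k H h.
  have := le_mx_linear_bound ('d (u k) x \- LL) h.
  move=> /le_trans; apply; rewrite ler_wpM2r//.
  apply: (@le_trans _ _ (\sum_(i < p) \sum_(j < q) (e / 3 / c))).
    by apply: ler_sum => i _; apply: ler_sum => j _; exact: H.
  rewrite !sumr_const !card_ord -mulrnA -(mulr_natr (e / 3 / c)) mulrAC ler_pdivrMr//.
  by rewrite ler_pM2l// ler_nat mulnC.
near=> y k.
have [Uy Hy] : U y /\ forall f, F f ->
    `|f y - f x| <= e / 3 /\ forall h, `|'d f y h - 'd f x h| <= e / 3 * `|h|.
  by near: y.
have gy : `|g y - g x| <= e / 3.
  apply: (@norm_cvg_le _ _ _ UU (fun k => u k y - u k x)).
    by apply: cvgB; exact: gP.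
  by apply: nearW => l; have [] := Hy _ (Fu l).
have Ly (D : _ -> _) h : D = L y -> `|D h - L x h| <= e / 3 * `|h|.
  move=> ->; apply: (@norm_cvg_le _ _ _ UU (fun k => 'd (u k) y h - 'd (u k) x h)).
    by apply: cvgB; exact: LP.
  by apply: nearW => l; have [_] := Hy _ (Fu l).
have tri (W : normedModType R) (a b c d : W) (t : R) :
    `|a - b| <= t / 3 -> `|b - c| <= t / 3 -> `|d - c| <= t / 3 -> `|a - d| <= t.
  move=> ab bc cd; rewrite -(subrKA b a) -(subrKA c b).
  rewrite distrC in cd.
  have := ler_normD (a - b) ((b - c) + (c - d)).
  have := ler_normD (b - c) (c - d); lra.
have [Hyu Hyd] := Hy _ (Fu k).
split.
  apply: tri Hyu _ gy; near: k; exact: g3.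
have dgE : 'd g y = L y :> (_ -> _) by have [] := pointwise_limit_is_diff Uy.
move=> h.
have Hk : forall h, `|'d (u k) x h - L x h| <= e / 3 * `|h| by near: k.
apply: (tri _ _ ('d (u k) x h) (L x h)); rewrite mulrAC.
- exact: Hyd.
- exact: Hk.
- exact: Ly dgE.
Unshelve. all: by end_near. Qed.

End pointwise_limit.

Lemma ultra_C1_limit x0 (M : R) : U x0 -> (\forall k \near UU, `|u k x0| <= M) ->
  exists g : 'M[R]_(p, q) -> 'M[R]_(m, n),
  (forall x, U x -> differentiable g x) /\
  forall K, compact K -> K `<=` U -> forall e : R, 0 < e ->
  \forall k \near UU, forall y, K y ->
    `|u k y - g y| <= e /\ forall h, `|'d (u k) y h - 'd g y h| <= e * `|h|.
Proof.
move=> Ux0 bu.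
have gP x : U x -> u k x @[k --> UU] --> lim (u k x @[k --> UU]).
  move=> Ux; have [N HN] := C1_equi_bounded_oscillation oU eF cU Ux0 Ux.
  apply: (@ultra_bounded_cvg _ _ _ _ _ _ (N + M)) => //.
  apply: filterS bu => k uM; rewrite -[u k x](subrK (u k x0)).
  by apply: le_trans (ler_normD _ _) _; rewrite lerD// HN.
have LP x h : U x ->
    'd (u k) x h @[k --> UU] --> lim ('d (u k) x h @[k --> UU]).
  move=> Ux; have [B _ HB] := C1_equi_diff_bound oU dF eF Ux.
  apply: (@ultra_bounded_cvg _ _ _ _ _ _ (B * `|h|)) => //.
  by apply: nearW => k; exact: HB.
exists (fun x => lim (u k x @[k --> UU])); split.
  by move=> x /(pointwise_limit_is_diff gP LP)[].
move=> K /compact_near_coveringP cK KU e e0.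
by apply: cK => x /KU Ux; exact: (near_C1_limit gP LP).
Qed.

Lemma ultra_unbounded x0 : U x0 ->
  (forall M : R, ~ \forall k \near UU, `|u k x0| <= M) ->
  forall K, compact K -> K `<=` U -> forall M : R,
  \forall k \near UU, forall y, K y -> M <= `|u k y|.
Proof.
move=> Ux0 nbu K /compact_near_coveringP cK KU M.
apply: cK => x /KU Ux.
have [N HN] := C1_equi_bounded_oscillation oU eF cU Ux0 Ux.
have big : \forall k \near UU, M + 1 + N <= `|u k x0|.
  have [H|H] := in_ultra_setVsetC [set k | `|u k x0| <= M + 1 + N] UF.
    by case: (nbu _ H).
  by apply: filterS H => k /= /negP; rewrite -ltNge => /ltW.
near=> y k.
have [_ /(_ _ (Fu k))[H1 _]] : U y /\ forall f, F f ->
    `|f y - f x| <= 1 /\ forall h, `|'d f y h - 'd f x h| <= 1 * `|h|.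
  by near: y; exact: (near_C1_equi oU eF Ux ltr01).
have H2 : M + 1 + N <= `|u k x0| by near: k.
have H3 := HN _ (Fu k).
have H4 : `|u k x0 - u k y| <= N + 1.
  rewrite distrC -(subrKA (u k x)); apply: le_trans (ler_normD _ _) _; lra.
have := ler_normD (u k x0 - u k y) (u k y); rewrite subrK /=; lra.
Unshelve. all: by end_near. Qed.

End limits_along_an_ultrafilter.

Lemma C1_equi_diff_bound_compact (R : realType) (V : normedModType R)
    (m n : nat) (U : set V) (F : set (V -> 'M[R]_(m, n))) (K : set V) :
  open U -> differentiable_family U F -> C1_equicontinuous U F ->
  compact K -> K `<=` U -> exists2 B : R, 0 <= B &
  forall f, F f -> forall y, K y -> forall h, `|'d f y h| <= B * `|h|.
Proof.
move=> oU dF eF /compact_near_coveringP cK KU.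
have /filter_ex[B HB] : \forall B \near +oo%R, K `<=` (fun y => forall f, F f ->
    forall h, `|'d f y h| <= B * `|h|).
  by apply: cK => x /KU Ux; exact: (near_C1_equi_diff_bound oU dF eF).
exists `|B| => // f Ff y Ky h; apply: le_trans (HB y Ky f Ff h) _.
by rewrite ler_wpM2r// ler_norm.
Qed.

(** Sets of a filter finer than [\oo] are infinite, so an index beyond the
    previous one can always be chosen. *)
Lemma ultra_subsequence (UU : set_system nat) (P : nat -> set nat) :
  ProperFilter UU -> \oo `<=` UU -> (forall m, UU (P m)) ->
  exists phi : nat -> nat,
    {homo phi : k l / (k < l)%N} /\ forall m, P m (phi m).
Proof.
move=> UF ooU HP.
have ex m a : exists b, (a < b)%N /\ P m b.
  apply: (@filter_ex _ UU); apply: filterI; last exact: HP.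
  by apply: ooU; exists a.+1.
have [s Hs] := choice (fun ma => ex ma.1 ma.2).
pose phi := fix phi k := if k is k'.+1 then s (k, phi k') else s (0, 0)%N.
exists phi; split; last by case=> [|k]; [exact: (Hs (0, 0)%N).2|exact: (Hs (k.+1, phi k)).2].
apply: homo_ltn => [|k]; first exact: ltn_trans.
exact: (Hs (k.+1, phi k)).1.
Qed.

(** * Euclidean norms in Cayley-Dickson algebras *)

Definition euclid (R : realType) (m n : nat) (A : 'M[R]_(m, n)) : R :=
  Num.sqrt (\sum_(i < m) \sum_(j < n) A i j ^+ 2).

Lemma norm_le_euclid (R : realType) (m n : nat) (A : 'M[R]_(m, n)) :
  `|A| <= euclid A.
Proof.
apply: mx_norm_le => [|i j]; first exact: sqrtr_ge0.
have s0 (k : 'I_m) (P : pred 'I_n) : 0 <= \sum_(l < n | P l) A k l ^+ 2.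
  by apply: sumr_ge0 => l _; exact: sqr_ge0.
rewrite -sqrtr_sqr ler_sqrt; last by apply: sumr_ge0 => k _; exact: s0.
rewrite (bigD1 i)//= (bigD1 j)//= -addrA lerDl addr_ge0//.
by apply: sumr_ge0 => k _; exact: s0.
Qed.

Lemma euclid_le_norm (R : realType) (m n : nat) (A : 'M[R]_(m, n)) :
  euclid A <= Num.sqrt (m * n)%:R * `|A|.
Proof.
rewrite -[X in _ * X](ger0_norm (normr_ge0 A)) -sqrtr_sqr -sqrtrM//.
rewrite ler_sqrt; last by rewrite mulr_ge0 ?sqr_ge0.
have : \sum_(i < m) \sum_(j < n) A i j ^+ 2 <= \sum_(i < m) \sum_(j < n) `|A| ^+ 2.
  apply: ler_sum => i _; apply: ler_sum => j _.
  by rewrite -real_normK ?num_real// ler_sqr ?nnegrE// mx_coord_le_norm.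
by rewrite !sumr_const !card_ord -mulrnA mulr_natl mulnC.
Qed.

Lemma euclidZ (R : realType) (m n : nat) (a : R) (A : 'M[R]_(m, n)) :
  euclid (a *: A) = `|a| * euclid A.
Proof.
rewrite /euclid -sqrtr_sqr -sqrtrM ?sqr_ge0//; congr Num.sqrt.
rewrite mulr_sumr; apply: eq_bigr => i _.
by rewrite mulr_sumr; apply: eq_bigr => j _; rewrite mxE exprMn.
Qed.

Lemma euclid_eq0 (R : realType) (m n : nat) (A : 'M[R]_(m, n)) :
  (euclid A == 0) = (A == 0).
Proof.
apply/eqP/eqP => [A0|->].
  by apply/eqP; rewrite -normr_le0 -A0 norm_le_euclid.
by rewrite -(scale0r (0 : 'M[R]_(m, n))) euclidZ normr0 mul0r.
Qed.

(** Conjugation only changes signs of coordinates, which makes it linear and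
    isometric in the maximum norm. *)
Lemma cconj_sign (R : realType) (r : nat) : exists s : 'I_(cdim r) -> R,
  (forall i, `|s i| = 1) /\ forall z : CD R r, cconj z = \row_i (s i * z 0 i).
Proof.
elim: r => [|r [s [s1 IH]]].
  exists (fun=> 1); split; first by move=> _; rewrite normr1.
  by move=> z; apply/rowP => i; rewrite mxE mul1r.
exists (fun k : 'I_(cdim r + cdim r) => if fintype.split k is inl i then s i else -1).
split=> [k|z]; first by case: (fintype.split k) => // _; rewrite normrN1.
apply/rowP => /= k; rewrite [RHS]mxE -[k]fintype.splitK; case: (fintype.split k) => i /=.
  by rewrite row_mxEl IH !mxE (unsplitK (inl i)).
by rewrite row_mxEr !mxE (unsplitK (inr i)) mulN1r.
Qed.

Lemma cconjN (R : realType) (r : nat) (z : CD R r) : cconj (- z) = - cconj z.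
Proof.
have [s [_ E]] := cconj_sign R r.
by apply/rowP => i; rewrite !E !mxE mulrN.
Qed.

Lemma cmulN (R : realType) (r : nat) (x y : CD R r) :
  cmul (- x) y = - cmul x y /\ cmul x (- y) = - cmul x y.
Proof.
elim: r x y => [|r IH] x y /=; first by rewrite mxE scaleNr scalerN.
have Nl a b := (IH a b).1; have Nr a b := (IH a b).2.
by split; rewrite !linearN/= ?cconjN ?Nl ?Nr opp_row_mx ?opprD ?opprK.
Qed.

Lemma creB (R : realType) (r : nat) (x y : CD R r) : cre (x - y) = cre x - cre y.
Proof.
elim: r x y => [|r IH] x y /=; first by rewrite !mxE.
by rewrite linearB IH.
Qed.

(** Both products are computed together, because the doubling
    formula turns one into the other on the second half of the coordinates. *)
Lemma cre_mul_conj (R : realType) (r : nat) (z : CD R r) :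
  cre (cmul z (cconj z)) = \sum_i z 0 i ^+ 2 /\
  cre (cmul (cconj z) z) = \sum_i z 0 i ^+ 2.
Proof.
elim: r z => [|r IH] z /=; first by rewrite big_ord1 !mxE expr2.
rewrite !(row_mxKl, row_mxKr) cconjN (cmulN _ _).1 (cmulN _ _).2 !creB.
have creN (x : CD R r) : cre (- x) = - cre x.
  by rewrite -sub0r creB -[0](subrr x) creB subrr sub0r.
rewrite !creN !opprK (IH (lsubmx z)).1 !(IH _).2 big_split_ord /=.
by split; congr (_ + _); apply: eq_bigr => i _; rewrite mxE.
Qed.

Lemma cabsE (R : realType) (r : nat) (z : CD R r) : cabs z = euclid z.
Proof. by rewrite /cabs (cre_mul_conj z).1 /euclid big_ord1. Qed.

Lemma cnabsE (R : realType) (r n : nat) (z : CDn R r n) : cnabs z = euclid z.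
Proof.
rewrite /cnabs /euclid; congr Num.sqrt; apply: eq_bigr => i _.
rewrite cabsE /euclid big_ord1 sqr_sqrtr.
  by apply: eq_bigr => j _; rewrite mxE.
by apply: sumr_ge0 => j _; exact: sqr_ge0.
Qed.

(** * Inversion *)

Definition sqeuclid (R : realType) (d : nat) (w : 'rV[R]_d) : R :=
  \sum_(i < d) w 0 i ^+ 2.

Lemma sqr_norm_le_sqeuclid (R : realType) (d : nat) (w : 'rV[R]_d) :
  `|w| ^+ 2 <= sqeuclid w.
Proof.
have : `|w| ^+ 2 <= euclid w ^+ 2.
  by rewrite ler_sqr ?nnegrE ?sqrtr_ge0 // norm_le_euclid.
by rewrite /euclid big_ord1 sqr_sqrtr// sumr_ge0// => i _; exact: sqr_ge0.
Qed.

Definition dotmul (R : realType) (d : nat) (w h : 'rV[R]_d) : R :=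
  \sum_(i < d) w 0 i * h 0 i.

Lemma dotmul_is_linear (R : realType) (d : nat) (w : 'rV[R]_d) :
  linear (dotmul w : 'rV[R]_d -> R).
Proof.
move=> a h k; rewrite /dotmul scaler_sumr -big_split/=; apply: eq_bigr => i _.
by rewrite !mxE mulrDr mulrCA.
Qed.

HB.instance Definition _ (R : realType) (d : nat) (w : 'rV[R]_d) :=
  GRing.isLinear.Build R 'rV[R]_d R _ (dotmul w) (dotmul_is_linear w).

Lemma dotmul_le (R : realType) (d : nat) (w h : 'rV[R]_d) :
  `|dotmul w h| <= d%:R * (`|w| * `|h|).
Proof.
apply: le_trans (ler_norm_sum _ _ _) _.
rewrite mulr_natl -[X in _ *+ X]card_ord -sumr_const; apply: ler_sum => i _.
by rewrite normrM ler_pM// mx_coord_le_norm.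
Qed.

(** The remainder at order one is [dotmul h h], of order two in h. *)
Lemma is_diff_sqeuclid (R : realType) (d : nat) (w : 'rV[R]_d) :
  is_diff w (@sqeuclid R d) (2 \*: dotmul w).
Proof.
apply: (@diff_of_first_order _ _ _ _ (2 \*: dotmul w)).
  exact: mx_linear_continuous.
move=> e e0; exists (e / (1 + d%:R)); first by rewrite divr_gt0// ltr_pwDl.
move=> h; rewrite ltr_pdivlMr ?ltr_pwDl// => hd.
have -> : sqeuclid (w + h) - sqeuclid w - (2 \*: dotmul w) h = dotmul h h.
  rewrite /= /sqeuclid /dotmul scaler_sumr -!sumrB; apply: eq_bigr => i _.
  by rewrite !mxE /GRing.scale/=; ring.
apply: le_trans (dotmul_le _ _) _; rewrite mulrA ler_wpM2r//.
apply: le_trans (ltW hd); rewrite mulrC ler_wpM2l// lerDr//.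
Qed.

Lemma differentiable_mx (R : realType) (V : normedModType R) (m n : nat)
    (f : V -> 'M[R]_(m, n)) x :
  (forall i j, differentiable (fun z => f z i j) x) -> differentiable f x.
Proof.
move=> H.
have -> : f = \sum_(i < m) \sum_(j < n) (fun z => f z i j *: delta_mx i j).
  apply/funext => z; rewrite fct_sumE [LHS]matrix_sum_delta.
  by apply: eq_bigr => i _; rewrite fct_sumE.
apply: differentiable_sum => i; apply: differentiable_sum => j.
exact: differentiableZl.
Qed.

Lemma diff_coord (R : realType) (V : normedModType R) (m n : nat)
    (f : V -> 'M[R]_(m, n)) x h i j : differentiable f x ->
  'd f x h i j = 'd (fun z => f z i j) x h.
Proof.
move=> df; have dh : derivable f x h by exact: diff_derivable.
have dfij : differentiable (fun z => f z i j) x.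
  apply: (@differentiable_comp _ _ _ _ f (fun M : 'M[R]_(m, n) => M i j)) => //.
  exact: differentiable_coord.
by have := derive_mx dh; rewrite deriveE// => ->; rewrite mxE deriveE.
Qed.

Lemma is_diff_invM (R : realType) (V : normedModType R) (f g df dg : V -> R)
    (x : V) : f x != 0 -> is_diff x f df -> is_diff x g dg ->
  is_diff x (fun z => (f z)^-1 * g z)
    (fun h => (f x)^-1 * dg h - g x * (f x ^- 2 * df h)).
Proof.
move=> fx0 [df1 dfE] [dg1 dgE].
have dV := differentiableV df1 fx0.
split; first exact: differentiableM.
rewrite (diffM dV dg1) diffV//; apply/funext => h /=.
by rewrite dfE dgE -[LHS]/(_ * _ + _ * (- _ * _)) -mulrN -mulNr.
Qed.

(** Each coordinate of [cinv w] is [+- w_i / |w|^2] in the Euclidean norm.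
    Differentiating it gives a term [h_i / |w|^2] and a term
    [2 <w, h> w_i / |w|^4], both of order [|h| / |w|^2]. *)
Lemma cinv_diff (R : realType) (r : nat) (w : CD R r) : w != 0 ->
  differentiable (@cinv R r) w /\
  forall h, `|'d (@cinv R r) w h| <= (1 + 2 * (cdim r)%:R) / `|w| ^+ 2 * `|h|.
Proof.
move=> w0.
have nw : 0 < `|w| by rewrite normr_gt0.
have nw2 : 0 < `|w| ^+ 2 by rewrite exprn_gt0.
have qw := sqr_norm_le_sqeuclid w.
have q0 : 0 < sqeuclid w by exact: lt_le_trans qw.
have [s [s1 sE]] := cconj_sign R r.
pose psi i j (z : CD R r) : R := (sqeuclid z)^-1 * (s j * z i j).
have psiE i j : (fun z => (@cinv R r) z i j) = psi i j.
  apply/funext => z; rewrite ord1 /cinv /psi sE !mxE cabsE /euclid big_ord1 sqr_sqrtr//.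
  by apply: sumr_ge0 => k _; exact: sqr_ge0.
have [dq dqE] := is_diff_sqeuclid w.
have dc i j : is_diff w (fun z : CD R r => s j * z i j) (fun h => s j * h i j).
  have dij : is_diff w (fun z : CD R r => z i j) (fun h => h i j).
    split; first exact: differentiable_coord.
    apply/funext => h; rewrite -(@diff_coord _ _ _ _ id)//.
    by have [_ ->] := is_diff_id w.
  exact: (is_diffZ (s j) dij).
have psid i j : is_diff w (psi i j)
    (fun h => (sqeuclid w)^-1 * (s j * h i j)
      - s j * w i j * (sqeuclid w ^- 2 * (2 * dotmul w h))).
  exact: is_diff_invM (lt0r_neq0 q0) (is_diff_sqeuclid w) (dc i j).
have cd : differentiable (@cinv R r) w.
  by apply: differentiable_mx => i j; rewrite psiE.
split=> // h; apply: mx_norm_le => [|i j].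
  by rewrite mulr_ge0// divr_ge0// ?addr_ge0 ?mulr_ge0// ltW.
rewrite diff_coord// psiE; have [_ ->] := psid i j.
have wi : `|w i j| <= `|w| := mx_coord_le_norm _ _ _.
have hi : `|h i j| <= `|h| := mx_coord_le_norm _ _ _.
have qi : (sqeuclid w)^-1 <= (`|w| ^+ 2)^-1 by rewrite lef_pV2 ?posrE.
have qi0 : 0 <= (sqeuclid w)^-1 by rewrite invr_ge0 ltW.
have -> : (1 + 2 * (cdim r)%:R) / `|w| ^+ 2 * `|h| =
    (`|w| ^+ 2)^-1 * `|h| + (`|w| ^+ 2)^-1 * (2 * (cdim r)%:R * `|h|) by ring.
apply: le_trans (ler_normB _ _) _; apply: lerD.
  by rewrite !normrM s1 mul1r (ger0_norm qi0) ler_pM.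
rewrite !normrM s1 mul1r -exprVn normrX (ger0_norm qi0) (ger0_norm (@ler0n R 2)).
apply: (@le_trans _ _ (`|w| * ((sqeuclid w)^-1 ^+ 2 *
    (2 * ((cdim r)%:R * (`|w| * `|h|)))))).
  by rewrite ler_pM ?mulr_ge0 ?exprn_ge0// ler_wpM2l ?exprn_ge0// ler_wpM2l// dotmul_le.
rewrite (_ : _ * _ = (`|w| ^+ 2 * (sqeuclid w)^-1) * ((sqeuclid w)^-1 *
    (2 * (cdim r)%:R * `|h|))); last by ring.
apply: (@le_trans _ _ ((sqeuclid w)^-1 * (2 * (cdim r)%:R * `|h|))).
  by rewrite ler_piMl ?mulr_ge0// ler_pdivrMr// mul1r.
by rewrite ler_wpM2r// ?mulr_ge0.
Qed.

Lemma diff_cinv_comp_le (R : realType) (r : nat) (V : normedModType R)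
    (f : V -> CD R r) (x : V) (B : R) :
  differentiable f x -> f x != 0 -> (forall h, `|'d f x h| <= B * `|h|) ->
  forall h, `|'d (fun y => cinv (f y)) x h - 'd (cst 0 : V -> CD R r) x h| <=
    (1 + 2 * (cdim r)%:R) / `|f x| ^+ 2 * (B * `|h|).
Proof.
move=> df fx0 HB h.
have [dc Hc] := cinv_diff fx0.
have sub (D D' E : V -> CD R r) (c : R) :
    D = D' -> E = 0 -> `|D' h| <= c -> `|D h - E h| <= c.
  by move=> -> ->; rewrite subr0.
apply: (sub _ _ _ _ (diff_comp df dc) (diff_cst _ _)).
by apply: le_trans (Hc _) _; rewrite ler_wpM2l// divr_ge0 ?exprn_ge0//.
Qed.

Lemma norm_cinv_le (R : realType) (r : nat) (w : CD R r) :
  `|cinv w| <= `|w|^-1.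
Proof.
have [->|w0] := eqVneq w 0.
  have [s [_ sE]] := cconj_sign R r.
  rewrite (_ : cinv 0 = 0) ?normr0 ?invr0//.
  by apply/rowP => i; rewrite /cinv sE !mxE !mulr0.
have nw : 0 < `|w| by rewrite normr_gt0.
have qw := sqr_norm_le_sqeuclid w.
have q0 : 0 < sqeuclid w by apply: lt_le_trans qw; rewrite exprn_gt0.
have [s [s1 sE]] := cconj_sign R r.
apply: mx_norm_le => [|i j]; first by rewrite invr_ge0 ltW.
rewrite /cinv sE !mxE normrM normrM s1 mul1r cabsE /euclid big_ord1 sqr_sqrtr; last first.
  by apply: sumr_ge0 => k _; exact: sqr_ge0.
rewrite -/(sqeuclid w) ger0_norm ?invr_ge0 ?(ltW q0)//.
rewrite mulrC ler_pdivrMr// (le_trans (mx_coord_le_norm w 0 j))//.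
by rewrite mulrC ler_pdivlMr// -expr2.
Qed.

(** Both [cinv (f x)] and its derivative are O(1 / |f x|), with a constant that
    depends on the bound B only. *)
Lemma cinv_C1_small (R : realType) (r : nat) (V : normedModType R)
    (f : V -> CD R r) (x : V) (B e : R) :
  0 <= B -> 0 < e -> differentiable f x ->
  (forall h, `|'d f x h| <= B * `|h|) ->
  1 + (1 + (1 + 2 * (cdim r)%:R) * B) / e <= `|f x| ->
  f x != 0 /\ (`|cinv (f x) - 0| <= e /\
    forall h, `|'d (fun y => cinv (f y)) x h -
                'd (cst 0 : V -> CD R r) x h| <= e * `|h|).
Proof.
move=> B0 e0 df HB.
pose D : R := 1 + 2 * (cdim r)%:R.
have D0 : 0 <= D by rewrite addr_ge0 ?mulr_ge0.
rewrite -/D; set C := 1 + D * B => fx.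
have C1 : 1 <= C by rewrite lerDl mulr_ge0.
have Ce0 : 0 < C / e by rewrite divr_gt0// (lt_le_trans ltr01).
have f1 : 1 <= `|f x| by apply: le_trans fx; rewrite lerDl ltW.
have fC : C / e <= `|f x| by apply: le_trans fx; rewrite lerDr.
have f0 : 0 < `|f x| by exact: lt_le_trans f1.
have fx0 : f x != 0 by rewrite -normr_gt0.
have Cf : C / `|f x| <= e by rewrite ler_pdivrMr// mulrC -ler_pdivrMr.
split=> //; split.
  rewrite subr0; apply: le_trans (norm_cinv_le _) _; apply: le_trans Cf.
  by rewrite ler_peMl// invr_ge0.
move=> h; apply: le_trans (diff_cinv_comp_le df fx0 HB h) _; rewrite -/D.
rewrite mulrA ler_wpM2r//; apply: le_trans Cf.
rewrite mulrAC; apply: ler_pM; rewrite ?mulr_ge0 ?invr_ge0 ?exprn_ge0//.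
  by rewrite lerDr.
by rewrite lef_pV2 ?posrE ?exprn_gt0// expr2 ler_peMr// ltW.
Qed.

(** * The distances of the statement and the maximum norm *)

Lemma opnorm_le (R : realType) (r n : nat) (A : CDn R r n -> CD R r) (e : R) :
  0 <= e -> (forall h, `|A h| <= e * `|h|) ->
  opnorm A <= Num.sqrt (cdim r)%:R * e.
Proof.
move=> e0 H; rewrite /opnorm.
set S := (X in sup X).
have [S0|/nonemptyPn ->] := pselect (S !=set0); last first.
  by rewrite sup0 mulr_ge0 ?sqrtr_ge0.
apply: ge_sup => // _ [h /= h1 <-]; rewrite cabsE.
apply: le_trans (euclid_le_norm _) _; rewrite mul1n ler_wpM2l ?sqrtr_ge0//.
apply: le_trans (H h) _; rewrite ler_piMr// -h1 cnabsE; exact: norm_le_euclid.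
Qed.

(** A linear map on matrices is bounded, so the supremum defining [opnorm] is
    that of a bounded set and bounds the value at [h / |h|]. *)
Lemma le_opnorm (R : realType) (r n : nat)
    (A : {linear CDn R r n -> CD R r}) h :
  `|A h| <= opnorm A * (Num.sqrt (n * cdim r)%:R * `|h|).
Proof.
have hs : has_ubound [set cabs (A h) | h in [set h : CDn R r n | cnabs h = 1]].
  exists (Num.sqrt (1 * cdim r)%:R * mx_linear_bound A) => _ [k /= k1 <-].
  rewrite cabsE; apply: le_trans (euclid_le_norm _) _.
  rewrite ler_wpM2l ?sqrtr_ge0//; apply: le_trans (le_mx_linear_bound A k) _.
  rewrite ler_piMr -?k1 ?cnabsE ?norm_le_euclid//.
  by apply: sumr_ge0 => i _; apply: sumr_ge0.
have [->|h0] := eqVneq h 0; first by rewrite linear0 !normr0 !mulr0.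
have e0 : 0 < euclid h by rewrite lt_neqAle sqrtr_ge0 eq_sym euclid_eq0 h0.
pose k := (euclid h)^-1 *: h.
have k1 : cnabs k = 1 by rewrite cnabsE euclidZ gtr0_norm ?invr_gt0// mulVf// gt_eqF.
have Ak : `|A k| <= opnorm A.
  apply: le_trans (norm_le_euclid _) _; rewrite -cabsE.
  by apply: ub_le_sup => //; exists k.
have -> : A h = euclid h *: A k.
  by rewrite -linearZ /k scalerA divff ?scale1r// gt_eqF.
rewrite normrZ gtr0_norm// mulrC.
apply: (@le_trans _ _ (opnorm A * euclid h)); first by rewrite ler_wpM2r// ltW.
by rewrite ler_wpM2l ?euclid_le_norm// (le_trans _ Ak).
Qed.

Lemma C1_dist_le (R : realType) (r n : nat) (f g : CDn R r n -> CD R r)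
    (z : CDn R r n) (e : R) :
  `|f z - g z| <= e -> (forall h, `|'d f z h - 'd g z h| <= e * `|h|) ->
  C1_dist f g z z <= Num.sqrt (cdim r)%:R * e *+ 2.
Proof.
move=> fg dfg; rewrite mulr2n /C1_dist lerD//.
  rewrite cabsE; apply: le_trans (euclid_le_norm _) _.
  by rewrite mul1n ler_wpM2l ?sqrtr_ge0.
by apply: opnorm_le => //; apply: le_trans fg.
Qed.

Lemma opnorm_ge0 (R : realType) (r n : nat) (A : CDn R r n -> CD R r) :
  0 <= opnorm A.
Proof.
rewrite /opnorm; set S := (X in sup X).
have [[hs hu]|/sup_out ->//] := pselect (has_sup S).
have [x Sx] := hs; apply: le_trans (ub_le_sup hu Sx).
by have [h _ <-] := Sx; exact: sqrtr_ge0.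
Qed.

Lemma uniformly_C1_continuous_equicontinuous (R : realType) (r n : nat)
    (U : set (CDn R r n)) (F : set (CDn R r n -> CD R r)) :
  uniformly_C1_continuous U F -> C1_equicontinuous U F.
Proof.
move=> H e e0.
pose c : R := Num.sqrt (n * cdim r)%:R.
have c0 : 0 <= c by exact: sqrtr_ge0.
have c1 : 0 < 1 + c by rewrite ltr_pwDl.
have [d d0 Hd] := H (e / (1 + c)) (divr_gt0 e0 c1).
exists (d / (1 + c)); first by rewrite divr_gt0.
move=> x y Ux Uy; rewrite ltr_pdivlMr// => xy f Ff.
have xyd : cnabs (x - y) < d.
  rewrite cnabsE; apply: le_lt_trans (euclid_le_norm _) _.
  rewrite -/c; apply: le_lt_trans xy.
  by rewrite mulrC ler_wpM2l// lerDr.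
have {}Hd := Hd _ _ Ux Uy xyd _ Ff.
have O0 := opnorm_ge0 (fun h => 'd f x h - 'd f y h).
have E0 : 0 <= cabs (f x - f y) by exact: sqrtr_ge0.
have ee : e / (1 + c) <= e by rewrite ler_pdivrMr// ler_peMr ?lerDl// ltW.
rewrite /C1_dist in Hd; split.
  apply: le_trans (norm_le_euclid _) _; rewrite -cabsE; lra.
move=> h; apply: le_trans (le_opnorm ('d f x \- 'd f y) h) _.
rewrite mulrA ler_wpM2r// -/c.
have H1 : opnorm ('d f x \- 'd f y) <= e / (1 + c).
  by apply/ltW; apply: le_lt_trans Hd; rewrite lerDr.
apply: le_trans (ler_wpM2r c0 H1) _.
by rewrite mulrAC ler_pdivrMr// ler_wpM2l ?lerDr// ltW.
Qed.

Lemma rho_dist_le (R : realType) (r n : nat) (V : set (CDn R r n))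
    (f g : CDn R r n -> CD R r) (e : R) :
  (forall z, V z -> `|f z - g z| <= e /\ forall h, `|'d f z h - 'd g z h| <= e * `|h|) ->
  (rho_dist V f g <= (Num.sqrt (cdim r)%:R * e *+ 2)%:E)%E.
Proof.
move=> H; apply: ge_ereal_sup => _ [z /H[H1 H2] <-].
by rewrite lee_fin C1_dist_le.
Qed.

Lemma rho_dist_ge0 (R : realType) (r n : nat) (V : set (CDn R r n))
    (f g : CDn R r n -> CD R r) : V !=set0 -> (0 <= rho_dist V f g)%E.
Proof.
move=> [z Vz]; apply: (@le_trans _ _ (C1_dist f g z z)%:E).
  by rewrite lee_fin addr_ge0 ?opnorm_ge0 ?sqrtr_ge0.
by apply: ereal_sup_ubound; exists z.
Qed.

Lemma cvge0_of_le_invS (R : realType) (c : R) (d : nat -> \bar R) :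
  (forall k, 0 <= d k)%E -> (forall k, d k <= (c * k.+1%:R^-1)%:E)%E ->
  d k @[k --> \oo] --> 0%:E.
Proof.
move=> d0 dc.
apply: (@squeeze_cvge _ _ _ _ (cst 0%:E) _ (fun k => (c * k.+1%:R^-1)%:E)).
- by apply: nearW => k; rewrite d0 dc.
- exact: cvg_cst.
- apply: cvg_EFin; first exact: nearW.
  by rewrite -(mulr0 c); apply: cvgMr; exact: cvg_harmonic.
Qed.

(** * Normality *)

Theorem theorem20 (R : realType) (r : nat) (hr : r = 2%N \/ r = 3%N)
  (n : nat) (hn : (0 < n)%N)
  (U : set (CDn R r n)) (hU : is_domain U)
  (F : set (CDn R r n -> CD R r))
  (hol : forall f, F f -> holomorphic_on U f)
  (pc : forall f, F f -> pseudoconformal_or_eq0 U f)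
  (hF : uniformly_C1_continuous U F) :
  normal_family U F.
Proof.
split=> // u V Fu cV bV _ V0 VU.
have [oU cU [x0 Ux0]] := hU.
have dF : differentiable_family U F by move=> f /hol hf x /hf[].
have eF := uniformly_C1_continuous_equicontinuous hF.
have kV : compact V by exact: mx_bounded_closed_compact.
have invS0 m : 0 < m.+1%:R^-1 :> R by rewrite invr_gt0.
have [UU [UF ooU]] := @ultraFilterLemma nat \oo _.
have [[M bu]|nbu] := pselect (exists M : R, \forall k \near UU, `|u k x0| <= M).
  have [g [dg Hg]] := ultra_C1_limit UF oU cU dF eF Fu Ux0 bu.
  have [phi [phiS Hphi]] :=
    ultra_subsequence _ ooU (fun m => Hg V kV VU _ (invS0 m)).
  exists phi; split=> //; left; exists g; split; first by move=> z /VU /dg.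
  apply: (@cvge0_of_le_invS _ (Num.sqrt (cdim r)%:R *+ 2)) => k.
    exact: rho_dist_ge0.
  by rewrite mulrnAl; apply: rho_dist_le => z /(Hphi k).
have {}nbu M : ~ \forall k \near UU, `|u k x0| <= M.
  by move=> H; apply: nbu; exists M.
have [B B0 HB] := C1_equi_diff_bound_compact oU dF eF kV VU.
have [phi [phiS Hphi]] := ultra_subsequence _ ooU (fun m =>
  ultra_unbounded UF oU cU eF Fu Ux0 nbu kV VU
    (1 + (1 + (1 + 2 * (cdim r)%:R) * B) / m.+1%:R^-1)).
have small k z : V z -> _ := fun Vz => cinv_C1_small B0 (invS0 k)
  (dF _ (Fu (phi k)) z (VU z Vz)) (HB _ (Fu (phi k)) z Vz) (Hphi k z Vz).
exists phi; split=> //; right; split.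
  by apply: nearW => k z /(small k)[].
apply: (@cvge0_of_le_invS _ (Num.sqrt (cdim r)%:R *+ 2)) => k.
  exact: rho_dist_ge0.
by rewrite mulrnAl; apply: rho_dist_le => z /(small k)[].
Qed.
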